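(* Let $c>0$, let $\underline{w}<\overline{w}$ be real numbers, and let $q(w)=(c-w)^2$. Let $\epsilon>0$. Then there exist a breakpoint set $\mathcal{B}$ in $[\underline{w},\overline{w}]$ and a MILP formulation of the piecewise linear function $\bar{q}_{\mathcal{B}}$ induced by $\mathcal{B}$ with $\mathcal{O}(1)\log(\frac{1}{\epsilon})$ binary variables and $\mathcal{O}(1)\frac{1}{\sqrt{\epsilon}}$ continuous variables and constraints, such that the relative $\ell_\infty$-approximation error $$\frac{\ell_\infty(\bar{q}_{\mathcal{B}},q)}{(\overline{w}-\underline{w})^2}$$ is at most $\epsilon$.
   Context: A breakpoint set in $[\underline{w},\overline{w}]$ is an ordered set $\mathcal{B}=(w_1,\dots,w_h)$, $h\ge2$, with $\underline{w}=w_1<\dots<w_h=\overline{w}$. The piecewise linear function induced by $\mathcal{B}$ is $$\bar{q}_{\mathcal{B}}(w):=\frac{q(w_k)-q(w_{k-1})}{w_k-w_{k-1}}(w-w_{k-1})+q(w_{k-1})\quad\text{for }w_{k-1}\le w\le w_k,\ 2\le k\le h.$$ The $\ell_\infty$-approximation error is $\ell_\infty(\bar{q}_{\mathcal{B}},q)=\max_{w\in[\underline{w},\overline{w}]}|\bar{q}_{\mathcal{B}}(w)-q(w)|$. A MILP (mixed-integer linear programming) formulation of $\bar{q}_{\mathcal{B}}$ is a system of linear equations and inequalities in $(w,t)$, auxiliary continuous variables and auxiliary binary variables, whose solution set projects onto the $(w,t)$-space exactly as the graph $\{(w,t):w\in[\underline{w},\overline{w}],\ t=\bar{q}_{\mathcal{B}}(w)\}$.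 $\mathcal{O}(1)$ denotes a factor bounded by an absolute constant, independent of $\epsilon$, $c$, $\underline{w}$ and $\overline{w}$.
   Formalization: For ε>1 the stated bounds cannot hold in general (at least one constraint and the variables w,t are needed), so continuous variables and constraints are bounded by O(1)·max(1,1/√ε) and binaries by O(1)·|log(1/ε)|; for ε≤1 these are the stated bounds. *)

(* Defs.v *)
From HB Require Import structures.
From mathcomp Require Import all_boot all_order all_algebra.
From mathcomp Require Import all_classical all_reals all_analysis.

Set Implicit Arguments.
Unset Strict Implicit.
Unset Printing Implicit Defensive.

Import Order.TTheory GRing.Theory Num.Theory.
Local Open Scope classical_set_scope.
Local Open Scope ring_scope.

Section PiecewiseLinear.
Context {R : realType}.
Implicit Types (q f g : R -> R) (B : seq R) (a b w : R).

Definition breakpoint_set a b B : Prop :=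
  [/\ (2 <= size B)%N, sorted <%R B, head 0 B = a & last 0 B = b].

Definition secant q a b w : R := (q b - q a) / (b - a) * (w - a) + q a.

(* The segment used at [w] is the leftmost one whose right end is at least [w];
   [pwlE] shows that any segment containing [w] gives the same value.  The
   value of [pwl q B] outside the interval spanned by [B] is irrelevant. *)
Definition pwl q B w : R :=
  let k := find (fun b => w <= b) (behead B) in secant q B`_k B`_k.+1 w.

Lemma secant_l q a b : secant q a b a = q a.
Proof. by rewrite /secant subrr mulr0 add0r. Qed.

Lemma secant_r q a b : a < b -> secant q a b b = q b.
Proof.
move=> ab; rewrite /secant divfK ?subrK //.
by rewrite subr_eq0 gt_eqF.
Qed.

Lemma pwlE q B k w : sorted <%R B -> (k.+1 < size B)%N ->
  B`_k <= w <= B`_k.+1 -> pwl q B w = secant q B`_k B`_k.+1 w.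
Proof.
move=> sB kB /andP[kw wk]; rewrite /pwl.
set j := find _ _.
have jk : (j <= k)%N.
  rewrite leqNgt; apply/negP => /(before_find 0).
  by rewrite nth_behead wk.
have jB : (j.+1 < size B)%N by exact: leq_ltn_trans kB.
have wj : w <= B`_j.+1.
  have : has (fun b => w <= b) (behead B).
    by rewrite has_find size_behead -ltnS prednK // (leq_trans _ jB).
  by move=> /(nth_find 0); rewrite nth_behead.
have [->//|jNk] := eqVneq j k.
have {}jk : (j < k)%N by rewrite ltn_neqAle jNk.
have ltB m n : (m < n)%N -> (n < size B)%N -> B`_m < B`_n.
  by move=> mn nB; rewrite (lt_sorted_ltn_nth 0 sB) // inE (ltn_trans mn).
have [jk1|jk1] := eqVneq j.+1 k; last first.
  have := ltB j.+1 k; rewrite ltn_neqAle jk1 jk => /(_ isT (ltnW kB)).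
  by rewrite ltNge (le_trans kw wj).
have wE : w = B`_k by apply/eqP; rewrite eq_le kw -jk1 wj.
by rewrite wE secant_l -jk1 secant_r // ltB.
Qed.

(* A supremum, which for continuous [f] and [g] is attained. *)
Definition linf_error a b f g : R := sup [set `|f w - g w| | w in `[a, b]].

Lemma linf_errorE a b f g w : a <= w <= b ->
  (forall v, a <= v <= b -> `|f v - g v| <= `|f w - g w|) ->
  linf_error a b f g = `|f w - g w|.
Proof.
move=> wab fgle.
have wI : [set` `[a, b]] w by rewrite /= in_itv.
apply/eqP; rewrite eq_le; apply/andP; split.
  apply: ge_sup; first by exists `|f w - g w|, w.
  by move=> _ [v /= + <-]; rewrite in_itv => /fgle.
apply: ub_le_sup; last by exists w.
by exists `|f w - g w| => _ [v /= + <-]; rewrite in_itv => /fgle.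
Qed.

End PiecewiseLinear.

Section MILP.
Context {R : realType}.

(* lc_w * w + lc_t * t + lc_x . x + lc_z . z  (= or <=)  lc_rhs,
   an equation exactly when [lc_eq] holds. *)
Record lin_constraint (n m : nat) := LinConstraint {
  lc_eq : bool;
  lc_w : R;
  lc_t : R;
  lc_x : 'rV[R]_n;
  lc_z : 'rV[R]_m;
  lc_rhs : R }.

Definition lc_lhs n m (l : lin_constraint n m)
    (w t : R) (x : 'rV[R]_n) (z : 'rV[bool]_m) : R :=
  lc_w l * w + lc_t l * t + \sum_i lc_x l 0 i * x 0 i
    + \sum_j lc_z l 0 j * (z 0 j)%:R.

Definition lc_sat n m (l : lin_constraint n m)
    (w t : R) (x : 'rV[R]_n) (z : 'rV[bool]_m) : bool :=
  if lc_eq l then lc_lhs l w t x z == lc_rhs l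
  else lc_lhs l w t x z <= lc_rhs l.

(* Bounds on the variables, including nonnegativity, have to be listed among
   the constraints; only the integrality of the binaries is implicit. *)
Record milp := Milp {
  milp_naux : nat;
  milp_nbin : nat;
  milp_constraints : seq (lin_constraint milp_naux milp_nbin) }.

(* [w] and [t] are counted as continuous variables. *)
Definition milp_ncont (F : milp) : nat := (milp_naux F).+2.

Definition milp_ncons (F : milp) : nat := size (milp_constraints F).

Definition milp_proj (F : milp) : set (R * R) :=
  [set p | exists (x : 'rV[R]_(milp_naux F)) (z : 'rV[bool]_(milp_nbin F)),
     all (fun l => lc_sat l p.1 p.2 x z) (milp_constraints F)].

Definition graph_on (a b : R) (f : R -> R) : set (R * R) :=
  [set p | a <= p.1 <= b /\ p.2 = f p.1].

Definition milp_formulation (a b : R) (f : R -> R) (F : milp) : Prop :=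
  milp_proj F = graph_on a b f.

End MILP.

Arguments lin_constraint : clear implicits.
Arguments milp : clear implicits.

(* Main.v *)
Require Import Defs.
From HB Require Import structures.
From mathcomp Require Import all_boot all_order all_algebra.
From mathcomp Require Import all_classical all_reals all_analysis.
From mathcomp Require Import ring lra.

(* The interpolant of [x ^ 2] at the points [i / 2 ^ k] of [0, 1] is
   [x - \sum_(1 <= s <= k) T^s(x) / 4 ^ s], where [T] is the tent map
   [x |-> min (2 x) (2 - 2 x)].  The graph of [T] over [0, 1] is described by
   four inequalities and one binary variable, so the interpolant has a
   formulation with [k] binaries and [O(k)] variables and constraints.  An
   affine change of variables carries [x ^ 2] to [(c - w) ^ 2] up to an affine
   term, which interpolation preserves.  The relative error is
   [1 / 4 ^ k.+1], and the least [k] making it at most [eps] satisfies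
   [4 ^ k < 1 / eps] unless [k = 0]. *)

Import Order.TTheory GRing.Theory Num.Theory.
Local Open Scope ring_scope.

Lemma scale_itv (R : realType) (a b x : R) : a < b -> 0 <= x <= 1 ->
  a <= a + (b - a) * x <= b.
Proof.
rewrite -subr_gt0 => ab /andP[x0 x1].
by rewrite lerDl mulr_ge0 ?(ltW ab) //= -lerBrDl -[leRHS]mulr1 ler_pM2l.
Qed.

(** * The tent map and the interpolant of the square on [0, 1] *)

Section Tent.
Context {R : realType}.
Implicit Types (x : R) (k i : nat).

Definition tent x : R := Num.min (2 * x) (2 - 2 * x).

Lemma tent_left x : x <= 1 / 2 -> tent x = 2 * x.
Proof. by move=> xh; apply/min_idPl; lra. Qed.

Lemma tent_right x : 1 / 2 <= x -> tent x = 2 - 2 * x.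
Proof. by move=> xh; apply/min_idPr; lra. Qed.

Lemma tent_itv x : 0 <= x <= 1 -> 0 <= tent x <= 1.
Proof.
move=> x01; have [xh|/ltW xh] := lerP x (1 / 2).
  by rewrite tent_left //; lra.
by rewrite tent_right //; lra.
Qed.

Lemma iter_tent_itv k x : 0 <= x <= 1 -> 0 <= iter k tent x <= 1.
Proof. by move=> x01; elim: k => //= k; exact: tent_itv. Qed.

Definition sawtooth k x : R := x - \sum_(s < k) iter s.+1 tent x / 4 ^+ s.+1.

(** After the first summand [tent x / 4], the sum is a quarter of the level-[k] sum at [tent x],
    that is, of [tent x - sawtooth k (tent x)]. *)
Lemma sawtoothS k x :
  sawtooth k.+1 x = x - tent x / 2 + sawtooth k (tent x) / 4.
Proof.
rewrite /sawtooth big_ord_recl /= expr1 mulrBl mulr_suml.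
under eq_bigr => i _.
  rewrite -[tent (tent _)]/(iter i.+2 tent x) iterSr exprSr invfM mulrA.
  over.
by rewrite /=; field.
Qed.

(** The right-hand side [(u + v) * x - u * v] is the chord of the square over a dyadic cell [u, v].
    The induction works because [tent] maps each cell of level [k.+1] affinely onto a cell of level
    [k]. *)
Lemma sawtooth_segment k i x : (i < 2 ^ k)%N ->
  i%:R / 2 ^+ k <= x <= i.+1%:R / 2 ^+ k ->
  sawtooth k x =
    (i%:R + i.+1%:R) / 2 ^+ k * x - i%:R / 2 ^+ k * (i.+1%:R / 2 ^+ k).
Proof.
elim: k i x => [|k IHk] i x.
  by case: i => // _ _; rewrite /sawtooth big_ord0 expr0; lra.
have p_gt0 : 0 < 2 ^+ k :> R by rewrite exprn_gt0.
have p_neq0 : 2 ^+ k != 0 :> R by rewrite gt_eqF.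
rewrite exprS ler_pdivrMr ?mulr_gt0 // ler_pdivlMr ?mulr_gt0 // => ik.
rewrite sawtoothS => /andP[ix xi].
have [ik'|ki] := ltnP i (2 ^ k).
  have ikR : i.+1%:R <= 2 ^+ k :> R by rewrite -natrX ler_nat.
  have xh : x <= 1 / 2.
    by rewrite -(ler_pM2r p_gt0); lra.
  rewrite tent_left // (IHk i) //; last first.
    by rewrite ler_pdivrMr // ler_pdivlMr //; apply/andP; split; lra.
  by rewrite -[i.+1]addn1 natrD; field.
have ikR : 2 ^+ k <= i%:R :> R by rewrite -natrX ler_nat.
have xh : 1 / 2 <= x.
  by rewrite -(ler_pM2r p_gt0); lra.
(* On the right half, [2 - 2 * x] reverses orientation, so the right end of cell [i] goes to the
   left end of cell [j]. *)
pose j := (2 ^ k.+1 - i.+1)%N.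
have jE : j%:R = 2 * 2 ^+ k - i.+1%:R :> R.
  by rewrite natrB // natrX exprS.
have jk : (j < 2 ^ k)%N.
  by rewrite ltn_subLR // expnS mul2n -addnn ltn_add2r ltnS.
rewrite tent_right // (IHk j) //; last first.
  rewrite ler_pdivrMr // ler_pdivlMr // -[j.+1]addn1 natrD jE -[i.+1]addn1 natrD.
  by move: xi; rewrite -[i.+1]addn1 natrD => xi; apply/andP; split; lra.
by rewrite -[j.+1]addn1 natrD jE -[i.+1]addn1 natrD; field.
Qed.

End Tent.

(** * Interpolation of the quadratic at equally spaced breakpoints *)

Section UniformInterpolation.
Context {R : realType}.
Variables (a b : R) (k : nat).
Hypothesis ab : a < b.

Let node i : R := a + (b - a) * (i%:R / 2 ^+ k).

Definition uniform_breakpoints : seq R := mkseq node (2 ^ k).+1.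

Let L_gt0 : 0 < b - a. Proof. by rewrite subr_gt0. Qed.
Let p_gt0 : 0 < 2 ^+ k :> R. Proof. by rewrite exprn_gt0. Qed.

Let node_lt i j : (i < j)%N -> node i < node j.
Proof.
by move=> ij; rewrite ltrD2l ltr_pM2l // ltr_pM2r ?invr_gt0 // ltr_nat.
Qed.

Lemma nth_uniform_breakpoints i :
  (i <= 2 ^ k)%N -> uniform_breakpoints`_i = node i.
Proof. by move=> ik; rewrite nth_mkseq. Qed.

Lemma uniform_breakpointsP : breakpoint_set a b uniform_breakpoints.
Proof.
have nodeN : node (2 ^ k) = b.
  by rewrite /node natrX divff ?gt_eqF // mulr1 addrC subrK.
split.
- by rewrite size_mkseq ltnS expn_gt0.
- apply: (homo_sorted (e := ltn)); last exact: iota_ltn_sorted.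
  exact: node_lt.
- by rewrite /= /node mul0r mulr0 addr0.
- rewrite -nth_last size_mkseq /= -[LHS]/(uniform_breakpoints`_(2 ^ k)).
  by rewrite nth_uniform_breakpoints.
Qed.

Lemma uniform_segment w : a <= w <= b ->
  exists2 i, (i < 2 ^ k)%N & node i <= w <= node i.+1.
Proof.
move=> /andP[aw wb].
have ex_i : exists i, w <= node i.+1.
  exists (2 ^ k).-1; rewrite prednK ?expn_gt0 // /node natrX divff ?gt_eqF //.
  by rewrite mulr1 addrC subrK.
(* Take the first node to the right of [w]; minimality puts the preceding node to its left. *)
case: (ex_minnP ex_i) => i wi i_min; exists i.
  rewrite -[leqRHS]prednK ?expn_gt0 // ltnS; apply: i_min.
  rewrite prednK ?expn_gt0 // /node natrX divff ?gt_eqF //.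
  by rewrite mulr1 addrC subrK.
rewrite wi andbT; case: i wi i_min => [|i] wi i_min.
  by rewrite /node mul0r mulr0 addr0.
by rewrite leNgt; apply/negP => /ltW /i_min; rewrite ltnn.
Qed.

Lemma pwl_uniform (q : R -> R) i w : (i < 2 ^ k)%N ->
  node i <= w <= node i.+1 ->
  pwl q uniform_breakpoints w = secant q (node i) (node i.+1) w.
Proof.
have [_ sB _ _] := uniform_breakpointsP => ik iwi.
have iN : uniform_breakpoints`_i = node i.
  by rewrite nth_uniform_breakpoints // ltnW.
have iSN : uniform_breakpoints`_i.+1 = node i.+1.
  by rewrite nth_uniform_breakpoints.
rewrite -iN -iSN; apply: pwlE; rewrite ?iN ?iSN //.
by rewrite size_mkseq ltnS.
Qed.

Variable c : R.
Let q w := (c - w) ^+ 2.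

Let secant_sqr u v w : u < v ->
  secant q u v w = (c - w) ^+ 2 + (w - u) * (v - w).
Proof. by rewrite -subr_gt0 => /gt_eqF/negbT vu; rewrite /secant /q; field. Qed.

(** With [w = a + (b - a) * x], the quadratic is an affine function of [x] plus
    [(b - a) ^+ 2 * x ^+ 2]; interpolation fixes the former and turns the square into [sawtooth]. *)
Lemma pwl_uniform_sawtooth x : 0 <= x <= 1 ->
  pwl q uniform_breakpoints (a + (b - a) * x) =
    (c - a) ^+ 2 - 2 * (c - a) * ((b - a) * x) + (b - a) ^+ 2 * sawtooth k x.
Proof.
move=> x01; have [i ik iwi] := uniform_segment _ (scale_itv _ _ _ _ ab x01).
rewrite (pwl_uniform _ _ _ ik iwi).
rewrite secant_sqr ?node_lt // (sawtooth_segment _ _ _ ik); last first.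
  by move: iwi; rewrite !lerD2l !ler_pM2l.
by rewrite /node; ring.
Qed.

Lemma linf_error_uniform :
  linf_error a b (pwl q uniform_breakpoints) q <= (b - a) ^+ 2 / 4 ^+ k.+1.
Proof.
apply: ge_sup.
  by exists `|pwl q uniform_breakpoints a - q a|, a => //=;
     rewrite in_itv /= lexx ltW.
move=> _ [w /= + <-]; rewrite in_itv /= => wab.
have [i ik iwi] := uniform_segment _ wab.
rewrite (pwl_uniform _ _ _ ik iwi) secant_sqr ?node_lt // /q.
rewrite [_ + _ * _]addrC addrK; have /andP[iw wi] := iwi.
rewrite ger0_norm ?mulr_ge0 ?subr_ge0 //.
(* The bound is the squared half-length of a cell. *)
have -> : (b - a) ^+ 2 / 4 ^+ k.+1 = ((node i.+1 - node i) / 2) ^+ 2.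
  have -> : 4 = 2 ^+ 2 :> R by rewrite expr2; ring.
  rewrite -exprM mulnC exprM -expr_div_n; congr (_ ^+ 2).
  rewrite /node -[i.+1]addn1 natrD exprS; field.
  by rewrite gt_eqF.
(* [(w - u) * (v - w)] equals [((v - u) / 2) ^+ 2] minus the squared distance of [w] to the
   midpoint. *)
by move: (node i) (node i.+1) => u v; have := sqr_ge0 (w - (u + v) / 2); lra.
Qed.

End UniformInterpolation.

(** * The mixed-integer formulation built from chained tent maps *)

Section TentFormulation.
Context {R : realType}.

(** One row linking consecutive iterates: [lift ord0 s] is index [s + 1] (the output), and
    [widen_ord] keeps index [s] (the input). *)
Definition tent_constraint {k} (s : 'I_k) (cy cx cz r : R) :
    lin_constraint R k.+1 k :=
  LinConstraint false 0 0
    (cy *: delta_mx 0 (lift ord0 s) + cx *: delta_mx 0 (widen_ord (leqnSn k) s))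
    (cz *: delta_mx 0 s) r.

Lemma sum_scale_delta_mx n c (j : 'I_n) (x : 'I_n -> R) :
  \sum_i (c *: delta_mx 0 j : 'rV[R]_n) 0 i * x i = c * x j.
Proof.
rewrite (bigD1 j) //= big1 ?addr0 => [|i ij]; rewrite !mxE eqxx /=.
  by rewrite eqxx mulr1.
by rewrite (negbTE ij) mulr0 mul0r.
Qed.

Lemma tent_constraint_sat k (s : 'I_k) cy cx cz r w t
    (x : 'rV[R]_k.+1) (z : 'rV[bool]_k) :
  lc_sat (tent_constraint s cy cx cz r) w t x z =
    (cy * x 0 (lift ord0 s) + cx * x 0 (widen_ord (leqnSn k) s)
       + cz * (z 0 s)%:R <= r).
Proof.
rewrite /lc_sat /lc_lhs /= !mul0r !add0r; congr (_ + _ <= _).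
  under eq_bigr do rewrite mxE mulrDl.
  by rewrite big_split /= !sum_scale_delta_mx.
exact: sum_scale_delta_mx.
Qed.

(* The binary [z] selects the branch of the minimum. *)
Lemma tent_of_ineqs (x y : R) (z : bool) :
  y - 2 * x <= 0 -> y + 2 * x <= 2 ->
  - y + 2 * x - 2 * z%:R <= 0 -> - y - 2 * x + 2 * z%:R <= 0 -> y = tent x.
Proof.
case: z => /= h1 h2 h3 h4.
  by rewrite tent_right; lra.
by rewrite tent_left; lra.
Qed.

(** The bounds on [x] make the row of the unselected branch hold: it reduces to [0 <= x] when [z] is
    false and to [x <= 1] when [z] is true. *)
Lemma ineqs_of_tent (x : R) : 0 <= x <= 1 ->
  let y := tent x in let z := 1 / 2 < x in
  [/\ y - 2 * x <= 0, y + 2 * x <= 2, - y + 2 * x - 2 * z%:R <= 0 &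
      - y - 2 * x + 2 * z%:R <= 0].
Proof.
move=> x01 /=; have [xh|/ltW xh] := lerP x (1 / 2).
  by rewrite tent_left //=; split; lra.
by rewrite tent_right //=; split; lra.
Qed.

Variables (a b c : R) (k : nat).

(* Auxiliary variable [s] holds the [s]-th tent iterate of
   [(w - a) / (b - a)]. *)
Definition sawtooth_milp : milp R :=
  @Milp R k.+1 k
   ([:: LinConstraint true 1 0 ((a - b) *: delta_mx 0 ord0) 0 a;
        LinConstraint true (2 * (c - a)) 1
          ((b - a) ^+ 2 *: \row_s (if s == ord0 then -1 else (4 ^+ s)^-1))
          0 ((c - a) ^+ 2 + 2 * (c - a) * a);
        LinConstraint false 0 0 (-1 *: delta_mx 0 ord0) 0 0;
        LinConstraint false 0 0 (1 *: delta_mx 0 ord0) 0 1]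
    ++ [seq tent_constraint s 1 (- 2) 0 0 | s <- enum 'I_k]
    ++ [seq tent_constraint s 1 2 0 2 | s <- enum 'I_k]
    ++ [seq tent_constraint s (- 1) 2 (- 2) 0 | s <- enum 'I_k]
    ++ [seq tent_constraint s (- 1) (- 2) 2 0 | s <- enum 'I_k]).

Lemma milp_ncons_sawtooth : milp_ncons sawtooth_milp = (4 * k.+1)%N.
Proof.
by rewrite /milp_ncons /= !size_cat !size_map -enumT size_enum_ord; ring.
Qed.

Lemma sawtooth_milp_sat w t (x : 'rV[R]_k.+1) (z : 'rV[bool]_k) :
  all (fun l => lc_sat l w t x z) (milp_constraints sawtooth_milp) <->
  [/\ w = a + (b - a) * x 0 ord0,
      t = (c - a) ^+ 2 - 2 * (c - a) * (w - a)
          + (b - a) ^+ 2 * (x 0 ord0 - \sum_(s < k) x 0 (lift ord0 s) / 4 ^+ s.+1),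
      0 <= x 0 ord0 <= 1 &
      forall s : 'I_k, let y := x 0 (lift ord0 s) in
        let x := x 0 (widen_ord (leqnSn k) s) in
        [/\ y - 2 * x <= 0, y + 2 * x <= 2, - y + 2 * x - 2 * (z 0 s)%:R <= 0 &
            - y - 2 * x + 2 * (z 0 s)%:R <= 0]].
Proof.
have z0 : \sum_j (0 : 'rV[R]_k) 0 j * (z 0 j)%:R = 0.
  by rewrite big1 // => j _; rewrite mxE mul0r.
have xs : \sum_i ((b - a) ^+ 2 *: \row_s (if s == ord0 then -1 else (4 ^+ s)^-1)
      : 'rV[R]_k.+1) 0 i * x 0 i =
    - (b - a) ^+ 2 * (x 0 ord0 - \sum_(s < k) x 0 (lift ord0 s) / 4 ^+ s.+1).
  under eq_bigr do rewrite 2!mxE -mulrA.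
  rewrite -mulr_sumr big_ord_recl /= mulN1r mulNr -mulrN opprD opprK.
  by congr (_ * (_ + _)); apply: eq_bigr => s _; rewrite mulrC.
rewrite /sawtooth_milp /= !all_cat !all_map {1 2 3 4}/lc_sat /lc_lhs /=.
rewrite z0 xs !sum_scale_delta_mx !mul0r !addr0 !add0r.
split.
  move=> /and5P[/eqP wE /eqP tE x_ge0 x_le1].
  move=> /and4P[/allP h1 /allP h2 /allP h3 /allP h4]; split; [lra|lra|lra|].
  move=> s /=; have sI : s \in Finite.enum 'I_k by rewrite -enumT mem_enum.
  move: (h1 s) (h2 s) (h3 s) (h4 s); rewrite sI /= !tent_constraint_sat.
  by move=> /(_ isT) + /(_ isT) + /(_ isT) + /(_ isT) => *; split; lra.
move=> [wE tE x01 h]; apply/and5P; split; [apply/eqP; lra|apply/eqP; lra|lra|lra|].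
by apply/and4P; split; apply/allP => s _ /=; rewrite tent_constraint_sat;
  have [] := h s => *; lra.
Qed.

Lemma sawtooth_milp_formulation : a < b ->
  milp_formulation a b (pwl (fun w => (c - w) ^+ 2) (uniform_breakpoints a b k))
    sawtooth_milp.
Proof.
move=> ab; have L_gt0 : 0 < b - a by rewrite subr_gt0.
apply/seteqP; split=> -[w t] /=.
  move=> [x [z /= /sawtooth_milp_sat[-> -> x01 xz]]].
  (* Whatever the binaries are, the tent rows determine each variable from the previous one, so
     [x 0 ord0] fixes them all. *)
  have xE (s : 'I_k.+1) : x 0 s = iter s tent (x 0 ord0).
    case: s => s; elim: s => [|s IHs] sk /=; first by congr (x 0 _); apply: val_inj.
    have /= [h1 h2 h3 h4] := xz (Ordinal (sk : (s < k)%N)).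
    rewrite -(IHs (ltnW sk)).
    have -> : Ordinal sk = lift ord0 (Ordinal (sk : (s < k)%N)).
      exact: val_inj.
    have -> : Ordinal (ltnW sk) =
        widen_ord (leqnSn k) (Ordinal (sk : (s < k)%N)).
      exact: val_inj.
    exact: tent_of_ineqs h1 h2 h3 h4.
  split.
    exact: scale_itv.
  rewrite pwl_uniform_sawtooth // [a + _ - a]addrC addKr.
  rewrite /sawtooth; congr (_ + _ * (_ - _)).
  by apply: eq_bigr => s _; rewrite xE.
move=> -[/andP[/= aw wb] /= ->]; pose y := (w - a) / (b - a).
have wE : w = a + (b - a) * y.
  by rewrite /y mulrCA divff ?gt_eqF // mulr1 addrC subrK.
have y01 : 0 <= y <= 1.
  by rewrite /y ler_pdivrMr // ler_pdivlMr // mul0r mul1r; apply/andP; split; lra.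
(* The binaries record which half of [0, 1] each iterate lies in; at 1/2 both branches agree. *)
exists (\row_s iter s tent y), (\row_s (1 / 2 < iter s tent y)).
apply/sawtooth_milp_sat; rewrite !mxE /=; split=> //.
  rewrite {1}wE pwl_uniform_sawtooth // /sawtooth wE [a + _ - a]addrC addKr.
  by congr (_ + _ * (_ - _)); apply: eq_bigr => s _; rewrite !mxE.
by move=> s; rewrite !mxE /=; apply: ineqs_of_tent; exact: iter_tent_itv.
Qed.

End TentFormulation.

(** * Choice of the depth and the size bounds *)

Lemma exists_depth (R : realType) (eps : R) : 0 < eps ->
  exists2 k : nat, (4 ^+ k.+1)^-1 <= eps & k = 0 \/ 4 ^+ k < eps^-1.
Proof.
move=> eps_gt0.
have ex_k : exists k, eps^-1 <= 4 ^+ k.+1.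
  exists (Num.truncn eps^-1); apply: (le_trans (ltW (truncnS_gt _))).
  by rewrite -natrX ler_nat ltnW // ltn_expl.
case: (ex_minnP ex_k) => k epsk k_min; exists k.
  by rewrite -[leRHS]invrK lef_pV2 ?posrE ?invr_gt0 // exprn_gt0.
case: k k_min {epsk} => [|k] k_min; [by left|right].
by rewrite ltNge; apply/negP => /k_min; rewrite ltnn.
Qed.

Theorem corollary4p1 (R : realType) :
  exists C : R,
  forall c wl wu eps : R, 0 < c -> wl < wu -> 0 < eps ->
  let q := fun w : R => (c - w) ^+ 2 in
  exists (B : seq R) (F : milp R),
  [/\ breakpoint_set wl wu B,
      milp_formulation wl wu (pwl q B) F,
      (milp_nbin F)%:R <= C * `|ln (1 / eps)|,
      (milp_ncont F)%:R <= C * Num.max 1 (1 / Num.sqrt eps)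
        /\ (milp_ncons F)%:R <= C * Num.max 1 (1 / Num.sqrt eps)
    & linf_error wl wu (pwl q B) q / (wu - wl) ^+ 2 <= eps].
Proof.
have ln4_gt0 : 0 < ln 4 :> R by apply: ln_gt0; lra.
have C_ge : 8 <= 8 + (ln 4)^-1 :> R by rewrite lerDl invr_ge0 ltW.
(* The 8 absorbs [k + 3] variables and [4 * (k + 1)] constraints, since both [k] and 1 are at most
   the maximum; [(ln 4)^-1] converts to logarithms in base 4. *)
exists (8 + (ln 4)^-1) => c wl wu eps _ wlu eps_gt0 q.
have [k epsk k_small] := exists_depth _ _ eps_gt0.
exists (uniform_breakpoints wl wu k), (sawtooth_milp wl wu c k).
have kM : k%:R <= Num.max 1 (1 / Num.sqrt eps).
  case: k_small => [->|k_small]; first by rewrite le_max ler01.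
  rewrite le_max; apply/orP; right; rewrite div1r.
  (* [k <= 2 ^ k], and [2 ^ k] is the square root of [4 ^ k], which is below [eps^-1]. *)
  apply: (@le_trans _ _ (2 ^+ k)).
    by rewrite -natrX ler_nat ltnW // ltn_expl.
  rewrite -(@ler_pXn2r _ 2) ?nnegrE ?invr_ge0 ?sqrtr_ge0 ?exprn_ge0 //.
  rewrite exprVn sqr_sqrtr ?(ltW eps_gt0) // -exprM mulnC exprM ltW //.
  by rewrite expr2 -natrM.
have M_ge1 : 1 <= Num.max 1 (1 / Num.sqrt eps) by rewrite le_max lexx.
split.
- exact: uniform_breakpointsP.
- exact: sawtooth_milp_formulation.
- rewrite [milp_nbin _]/= mulrDl.
  (* Depth 0 uses no binaries, so the bound holds even where the logarithm vanishes; otherwise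
     [k * ln 4 = ln (4 ^ k)] is at most [ln (1 / eps)]. *)
  case: k_small => [->|k_small].
    by rewrite addr_ge0 // mulr_ge0 // invr_ge0 ltW.
  apply: (@le_trans _ _ ((ln 4)^-1 * `|ln (1 / eps)|)); last first.
    by rewrite lerDr mulr_ge0.
  rewrite mulrC ler_pdivlMr // div1r; apply: le_trans (ler_norm _).
  rewrite mulr_natl -lnXn ?ltr0n // ler_ln ?posrE ?invr_gt0 ?exprn_gt0 //.
  exact: ltW.
- split.
    apply: (@le_trans _ _ (8 * Num.max 1 (1 / Num.sqrt eps))).
      by rewrite /milp_ncont /= -[k.+3]addn3 natrD; lra.
    by rewrite ler_pM2r // (lt_le_trans ltr01).
  rewrite milp_ncons_sawtooth.
  apply: (@le_trans _ _ (8 * Num.max 1 (1 / Num.sqrt eps))).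
    by rewrite natrM -[k.+1]addn1 natrD; lra.
  by rewrite ler_pM2r // (lt_le_trans ltr01).
- have L_gt0 : 0 < (wu - wl) ^+ 2 by rewrite exprn_gt0 ?subr_gt0.
  rewrite ler_pdivrMr //; apply: le_trans (linf_error_uniform _ _ k wlu c) _.
  by rewrite mulrC ler_pM2r.
Qed.
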